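(* Let $D$ be a weighted oriented graph whose underlying graph $G$ is isomorphic to the cycle $C_n$ with $n$ vertices ($n\geq 3$). Then $I(D)$ is unmixed if and only if one of the following conditions holds: 1) $n=3$ and there is $x\in V(D)$ such that $w(x)=1$. 2) $n\in\{4,5,7\}$ and the vertices of $V^{+}$ are sinks. 3) $n=5$, there is $(x,y)\in E(D)$ with $w(x)=w(y)=1$, and $D\not\simeq D_1$, $D\not\simeq D_2$, $D\not\simeq D_3$. 4) $D\simeq D_4$.
   Context: A weighted oriented graph is a triplet $D=(V(D),E(D),w)$ where $V=V(D)$ is a finite set, $E=E(D)\subseteq V\times V$ is the edge set of an oriented graph (no loops, and for $x\neq y$ at most one of $(x,y),(y,x)$ is in $E$), and $w:V\to\mathbb{N}=\{1,2,\dots\}$ is the weight function. Its underlying graph $G$ is the simple graph on $V$ with edge set $\{\{x,y\}:(x,y)\in E\}$. Put $V^{+}=\{x\in V: w(x)\neq 1\}$. A source is a vertex with no in-neighbours; a sink is a vertex $y$ with no out-neighbours, i.e. all edges at $y$ are of the form $(x,y)$. Standing assumption: if $x$ is a source of $D$, then $w(x)=1$. The edge ideal $I(D)$ is the ideal of the polynomial ring over a field $K$ whose variables are the vertices of $D$, generated by the monomials $ab^{w(b)}$ for $(a,b)\in E$. An ideal is unmixed if all its associated primes have the same height. $D_1,D_2,D_3,D_4$ denote the following types of weighted oriented 5-cycles on vertices $x_1,\dots,x_5$ with underlying cycle $(x_1,x_2,x_3,x_4,x_5,x_1)$; $D\simeq D_i$ means that the vertices of $D$ can be labelled $x_1,\dots,x_5$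 so that $D$ has the described edges and weights (an edge listed as ''arbitrarily oriented'' may have either orientation, and a weight listed as $\neq 1$ may be any integer $\geq 2$). - $D_1$: edges $(x_2,x_1),(x_5,x_1),(x_4,x_5),(x_4,x_3),(x_3,x_2)$; weights $w(x_1)=w(x_2)=w(x_4)=1$, $w(x_3)\neq 1$, $w(x_5)\neq 1$. - $D_2$: edges $(x_3,x_2),(x_2,x_1),(x_1,x_5)$ and the edges $\{x_5,x_4\}$, $\{x_4,x_3\}$ arbitrarily oriented; weights $w(x_1)\neq 1$, $w(x_2)\neq 1$, $w(x_3)=w(x_4)=w(x_5)=1$. - $D_3$: edges $(x_1,x_5),(x_5,x_4),(x_4,x_3)$ and the edges $\{x_1,x_2\}$, $\{x_2,x_3\}$ arbitrarily oriented; weights $w(x_1)=w(x_2)=1$, $w(x_3)\neq 1$, $w(x_4)\neq 1$, $w(x_5)\neq 1$. - $D_4$: edges $(x_1,x_2),(x_2,x_3),(x_4,x_3),(x_4,x_5)$ and the edge $\{x_5,x_1\}$ arbitrarily oriented; weights $w(x_1)=w(x_4)=1$, $w(x_2)\neq 1$, $w(x_3)\neq 1$, $w(x_5)\neq 1$. *)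

(* Defs.v *)
From HB Require Import structures.
From mathcomp Require Import all_boot all_order all_algebra.
From mathcomp Require Import mpoly.

Set Implicit Arguments.
Unset Strict Implicit.
Unset Printing Implicit Defensive.

Import GRing.Theory.

Local Open Scope ring_scope.

Record wograph (V : finType) : Type := WOGraph {
  edge : rel V;  (* edge x y: the edge is oriented from x to y *)
  weight : V -> nat;
  edge_irr : forall x, ~~ edge x x;
  edge_asym : forall x y, edge x y -> ~~ edge y x;
  weight_gt0 : forall x, (0 < weight x)%N
}.

Definition adj (V : finType) (D : wograph V) : rel V :=
  fun x y => edge D x y || edge D y x.

Definition source (V : finType) (D : wograph V) (x : V) : bool :=
  [forall y, ~~ edge D y x].

Definition sink (V : finType) (D : wograph V) (x : V) : bool :=
  [forall y, ~~ edge D x y].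

Definition Vplus (V : finType) (D : wograph V) : {set V} :=
  [set x | weight D x != 1%N].

Definition cycle_adj (n : nat) : rel 'I_n :=
  fun i j => ((j == i.+1 %% n :> nat) || (i == j.+1 %% n :> nat))%N.

(* x is an isomorphism from C_n (on 0, ..., n-1) to the underlying graph of D.
   C_n is only meaningful for n >= 3. *)
Definition cycle_labelling (n : nat) (V : finType) (D : wograph V)
    (x : 'I_n -> V) : Prop :=
  bijective x /\ forall i j, adj D (x i) (x j) = cycle_adj i j.

Definition underlying_cycle (n : nat) (V : finType) (D : wograph V) : Prop :=
  exists x : 'I_n -> V, cycle_labelling D x.

(* x1, ..., x5 are all the vertices of D, and the underlying graph of D is the
   cycle (x1, x2, x3, x4, x5, x1); the orientation of an edge that is not
   constrained further is arbitrary. *)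
Definition five_cycle (V : finType) (D : wograph V) (x1 x2 x3 x4 x5 : V) :
    Prop :=
  cycle_labelling D (tnth [tuple x1; x2; x3; x4; x5]).

Definition is_D1 (V : finType) (D : wograph V) : Prop :=
  exists x1 x2 x3 x4 x5 : V,
    [/\ five_cycle D x1 x2 x3 x4 x5,
        [/\ edge D x2 x1, edge D x5 x1, edge D x4 x5, edge D x4 x3
          & edge D x3 x2],
        [/\ weight D x1 = 1%N, weight D x2 = 1%N & weight D x4 = 1%N]
      & weight D x3 <> 1%N /\ weight D x5 <> 1%N].

Definition is_D2 (V : finType) (D : wograph V) : Prop :=
  exists x1 x2 x3 x4 x5 : V,
    [/\ five_cycle D x1 x2 x3 x4 x5,
        [/\ edge D x3 x2, edge D x2 x1 & edge D x1 x5],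
        weight D x1 <> 1%N /\ weight D x2 <> 1%N
      & [/\ weight D x3 = 1%N, weight D x4 = 1%N & weight D x5 = 1%N]].

Definition is_D3 (V : finType) (D : wograph V) : Prop :=
  exists x1 x2 x3 x4 x5 : V,
    [/\ five_cycle D x1 x2 x3 x4 x5,
        [/\ edge D x1 x5, edge D x5 x4 & edge D x4 x3],
        weight D x1 = 1%N /\ weight D x2 = 1%N
      & [/\ weight D x3 <> 1%N, weight D x4 <> 1%N & weight D x5 <> 1%N]].

Definition is_D4 (V : finType) (D : wograph V) : Prop :=
  exists x1 x2 x3 x4 x5 : V,
    [/\ five_cycle D x1 x2 x3 x4 x5,
        [/\ edge D x1 x2, edge D x2 x3, edge D x4 x3 & edge D x4 x5],
        weight D x1 = 1%N /\ weight D x4 = 1%N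
      & [/\ weight D x2 <> 1%N, weight D x3 <> 1%N & weight D x5 <> 1%N]].

(* The polynomial ring over K whose variables are the elements of V. *)
Definition vpoly (K : fieldType) (V : finType) : comNzRingType :=
  {mpoly K[#|V|]}.

Definition vvar (K : fieldType) (V : finType) (v : V) : vpoly K V :=
  'X_(enum_rank v).

Definition edge_ideal (K : fieldType) (V : finType) (D : wograph V)
    (f : vpoly K V) : Prop :=
  exists c : V * V -> vpoly K V,
    f = \sum_(p : V * V | edge D p.1 p.2)
          c p * (vvar K p.1 * vvar K p.2 ^+ weight D p.2).

(* idealr_closed includes properness (1 \notin P). *)
Definition prime_ideal (R : comNzRingType) (P : {pred R}) : Prop :=
  idealr_closed P /\ prime_idealr_closed P.

(* P is prime and P = (I : f) for some f. *)
Definition associated_prime (R : comNzRingType) (I : R -> Prop)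
    (P : {pred R}) : Prop :=
  prime_ideal P /\ exists f : R, forall g : R, g \in P <-> I (g * f).

(* There is a strict chain Q 0 < Q 1 < ... < Q h = P of prime ideals. *)
Definition prime_chain (R : comNzRingType) (P : {pred R}) (h : nat) : Prop :=
  exists Q : nat -> {pred R},
    [/\ forall i, (i <= h)%N -> prime_ideal (Q i),
        forall i, (i < h)%N ->
          {subset Q i <= Q i.+1} /\ ~ {subset Q i.+1 <= Q i}
      & Q h =i P].

Definition has_height (R : comNzRingType) (P : {pred R}) (h : nat) : Prop :=
  prime_chain P h /\ forall k, prime_chain P k -> (k <= h)%N.

Definition unmixed (R : comNzRingType) (I : R -> Prop) : Prop :=
  exists h : nat, forall P : {pred R}, associated_prime I P -> has_height P h.

(* Main.v *)
(* The associated primes of I(D) are the ideals generated by the strong vertex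
   covers C of D: the vertex covers such that every v in C with all its
   neighbours in C has an in-neighbour y of weight <> 1 all of whose
   out-neighbours are in C. Indeed (I(D) : f) prime forces it to be generated by
   variables and to be a colon by a monomial u, and the exponent of v in u is then
   0, w(v) - 1, or (off C) arbitrarily large. The height of the ideal generated by
   the variables in C is #|C|, because a chain of primes in K[x_1, ..., x_m]
   yields as many algebraically independent elements as its length. Hence I(D)
   is unmixed iff all strong vertex covers have the same size. Minimal covers are
   strong, so C_n has to be well covered, i.e. n is 3, 4, 5 or 7; these cases are
   settled by looking at the orientations and at V^+. *)
Require Import Defs.
From Stdlib Require Import Classical_Prop.
From HB Require Import structures.
From mathcomp Require Import all_boot all_order all_algebra.
From mathcomp Require Import mpoly zify ring.

Set Implicit Arguments.
Unset Strict Implicit.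
Unset Printing Implicit Defensive.

Import GRing.Theory.

Local Open Scope ring_scope.

(** * Krull dimension of a polynomial ring *)

Section PrimeIdeals.
Variables (R : comNzRingType) (P : {pred R}).
Hypothesis primeP : prime_ideal P.

Lemma prime0 : 0 \in P. Proof. by case: primeP => -[]. Qed.

Lemma prime1 : 1 \notin P. Proof. by case: primeP => -[]. Qed.

Lemma primeD u v : u \in P -> v \in P -> u + v \in P.
Proof. by case: primeP => -[_ _ h] _ uP vP; rewrite -[u]mul1r h. Qed.

Lemma primeMr a u : u \in P -> a * u \in P.
Proof.
by case: primeP => -[P0 _ h] _ uP; rewrite -[a * u]addr0 h.
Qed.

Lemma primeMl a u : u \in P -> u * a \in P.
Proof. by rewrite mulrC; apply: primeMr. Qed.

Lemma primeB u v : u \in P -> v \in P -> u - v \in P.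
Proof. by move=> uP vP; rewrite -mulN1r primeD // primeMr. Qed.

Lemma primeDr u v : u \in P -> (u + v \in P) = (v \in P).
Proof.
move=> uP; apply/idP/idP => [uvP|]; last exact: primeD.
by rewrite -(addKr u v) addrC primeB.
Qed.

Lemma primeDl u v : v \in P -> (u + v \in P) = (u \in P).
Proof. by rewrite addrC; apply: primeDr. Qed.

Lemma prime_sum (I : Type) (r : seq I) (Q : pred I) (F : I -> R) :
  (forall i, Q i -> F i \in P) -> \sum_(i <- r | Q i) F i \in P.
Proof. by move=> h; elim/big_ind: _ => //; [exact: prime0|exact: primeD]. Qed.

Lemma primeM u v : (u * v \in P) = (u \in P) || (v \in P).
Proof.
case: primeP => _ h; apply/idP/orP => [/h/orP //|[]]; last exact: primeMr.
exact: primeMl.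
Qed.

Lemma primeX u k : u ^+ k \in P -> u \in P.
Proof.
elim: k => [|k IH]; first by rewrite expr0 (negPf prime1).
by rewrite exprS primeM => /orP[].
Qed.

End PrimeIdeals.

Section Dimension.
Variables (K : fieldType) (n : nat).
Local Notation A := {mpoly K[n]}.

(* The value at s of the polynomial whose coefficient at the monomial with
   exponents d_1, ..., d_r < N is c (d_1 + N d_2 + ... + N^(r-1) d_r). *)
Fixpoint digit_eval (N : nat) (s : seq A) (c : nat -> K) : A :=
  if s is q :: s' then
    \sum_(j < N) digit_eval N s' (fun i => c (i * N + j)%N) * q ^+ j
  else (c 0%N)%:MP.

Lemma digit_eval0 N s c :
  (forall i, (i < N ^ size s)%N -> c i = 0) -> digit_eval N s c = 0.
Proof.
elim: s c => [|q s IH] c hc /=; first by rewrite hc // mpolyC0.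
apply: big1 => j _; rewrite IH ?mul0r // => i hi; apply: hc => /=.
have := ltn_ord j; rewrite expnS mulnC; nia.
Qed.

Lemma digit_eval_linear N s a c d :
  digit_eval N s (fun i => a * c i + d i) =
  a *: digit_eval N s c + digit_eval N s d.
Proof.
elim: s c d => [|q s IH] c d /=.
  by rewrite mpolyCD mpolyCM mul_mpolyC.
rewrite scaler_sumr -big_split /=; apply: eq_bigr => j _.
by rewrite IH mulrDl scalerAl.
Qed.

(** Algebraic independence of [s] over [K] modulo [P], tested on polynomials with all exponents
    below [N]. *)
Definition digit_free (P : {pred A}) (N : nat) (s : seq A) : Prop :=
  forall c, digit_eval N s c \in P ->
    forall i, (i < N ^ size s)%N -> c i = 0.

(** Read the relation as a polynomial in [q]. Modulo [Q] only its constant term remains, and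
    freeness kills that term. What is left is [q] times an element, which lies in [P] as [q] does
    not, so the argument repeats for the next coefficient. *)
Lemma digit_free_cons (P Q : {pred A}) N s q :
  prime_ideal P -> prime_ideal Q -> {subset P <= Q} -> q \in Q -> q \notin P ->
  digit_free Q N s -> digit_free P N (q :: s).
Proof.
move=> pP pQ PQ qQ qP fQ c hc.
pose cf j i := c (i * N + j)%N; pose b j := digit_eval N s (cf j).
have step j : (j <= N)%N ->
    \sum_(k < N - j) b (j + k)%N * q ^+ k \in P /\
    forall k i, (k < j)%N -> (i < N ^ size s)%N -> cf k i = 0.
  elim: j => [|j IH] jN.
    by split=> //; rewrite subn0; apply: hc.
  have [] := IH (ltnW jN) => hP hcf.
  move: hP; have -> : (N - j = (N - j.+1).+1)%N by lia.
  rewrite big_ord_recl expr0 mulr1 addn0.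
  set S := \sum_(i < _) _.
  have -> : S = q * \sum_(k < N - j.+1) b (j.+1 + k)%N * q ^+ k.
    rewrite mulr_sumr; apply: eq_bigr => k _.
    by rewrite lift0 addnS addSn exprS mulrCA.
  move=> hP; have bQ : b j \in Q.
    by move: (PQ _ hP); rewrite primeDl // primeMl.
  have cj i : (i < N ^ size s)%N -> cf j i = 0 by apply: fQ.
  have b0 : b j = 0 by apply: digit_eval0.
  move: hP; rewrite b0 add0r primeM // (negPf qP) /= => hP; split=> //.
  move=> k i; rewrite ltnS leq_eqVlt => /predU1P[-> //|]; [exact: cj|exact: hcf].
move=> i hi; have [N0|N0] := posnP N; first by move: hi; rewrite N0 exp0n.
have [_ /(_ (i %% N) (i %/ N))%N] := step N (leqnn N).
rewrite /cf -divn_eq; apply; first exact: ltn_pmod.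
by rewrite ltn_divLR // mulnC -expnS.
Qed.

Lemma msizeM_leS (p q : A) a b :
  (msize p <= a.+1)%N -> (msize q <= b.+1)%N -> (msize (p * q) <= (a + b).+1)%N.
Proof.
move=> pa qb; have [->|p0] := eqVneq p 0; first by rewrite mul0r msize0.
have [->|q0] := eqVneq q 0; first by rewrite mulr0 msize0.
by rewrite msizeM // -subn1 leq_subLR add1n -addSn -addnS leq_add.
Qed.

Lemma digit_eval_deg N s c d :
  (forall q, q \in s -> (msize q <= d.+1)%N) ->
  (msize (digit_eval N s c) <= (size s * N * d).+1)%N.
Proof.
elim: s c => [|q s IH] c hs /=; first by rewrite msizeC; case: (_ != _).
apply: leq_trans (msize_sum _ _ _) _.
apply/bigmax_leqP => j _.
have qd : (msize q <= d.+1)%N by apply: hs; rewrite inE eqxx.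
have qX k : (msize (q ^+ k) <= (k * d).+1)%N.
  elim: k => [|k IHk]; first by rewrite expr0 msize1.
  by rewrite exprS mulSn; apply: msizeM_leS.
apply: leq_trans (msizeM_leS (IH _ _) (qX j)) _.
  by move=> r rs; apply: hs; rewrite inE rs orbT.
by rewrite mulSn mulnDl addnC ltnS leq_add2r leq_mul2r ltnW ?orbT.
Qed.

(** A relation has [N ^ size s] unknown coefficients, while its value has degree linear in [N],
    hence at most a constant times [N ^ n] coefficients. For large [N] the unknowns outnumber the
    equations. *)
Lemma digit_dependent (s : seq A) : (n < size s)%N ->
  exists N, exists c : nat -> K,
    digit_eval N s c = 0 /\ exists i, (i < N ^ size s)%N /\ c i != 0.
Proof.
move=> ns; pose d := (\max_(q <- s) msize q)%N.
have hd q : q \in s -> (msize q <= d.+1)%N.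
  by move=> qs; apply: leqW; apply: leq_bigmax_seq.
(* With this [k] the exponent bound [B] is at most [k * N], and [k ^ n < N] then gives
   [(k * N) ^ n < N ^ n.+1]. *)
set r := size s; pose k := (r * d).+1; pose N := (k ^ n).+1.
pose B := (r * N * d).+1.
pose T : finType := {ffun 'I_n -> 'I_B}.
pose mon (e : T) : 'X_{1..n} := [multinom (e i : nat) | i < n].
have cardT : (#|T| < N ^ r)%N.
  rewrite card_ffun !card_ord.
  have BkN : (B <= k * N)%N by rewrite /B /k; nia.
  apply: (@leq_ltn_trans ((k * N) ^ n)).
    by have [n0|n0] := posnP n; [rewrite n0 !expn0 | rewrite leq_exp2r].
  apply: (@leq_trans (N ^ n.+1)); last by rewrite leq_pexp2l.
  by rewrite expnMn expnS ltn_pmul2r // expn_gt0.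
pose cf (v : 'rV[K]_(N ^ r)) i := if insub i is Some j then v 0 j else 0.
pose f (v : 'rV[K]_(N ^ r)) : 'rV[K]_#|T| :=
  \row_j (digit_eval N s (cf v))@_(mon (enum_val j)).
have cf_lin a u v i : cf (a *: u + v) i = a * cf u i + cf v i.
  by rewrite /cf; case: insubP => [j _ _|_]; rewrite ?mxE // mulr0 addr0.
have ext c c' : c =1 c' -> digit_eval N s c = digit_eval N s c'.
  elim: (s) c c' => [|q t IH] c c' e /=; first by rewrite e.
  by apply: eq_bigr => j _; rewrite (IH _ (fun i => c' (i * N + j)%N)).
have f_lin : linear f.
  move=> a u v; apply/rowP => j; rewrite !mxE (ext _ _ (cf_lin a u v)).
  by rewrite digit_eval_linear mcoeffD mcoeffZ.
pose fL := GRing.isLinear.Build _ _ _ _ f f_lin.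
pose fl : {linear 'rV[K]_(N ^ r) -> 'rV[K]_#|T|} := HB.pack f fL.
(* The matrix has more rows than columns, so some nonzero coefficient vector has value 0. *)
have : kermx (lin1_mx fl) != 0.
  rewrite kermx_eq0 /row_free; apply: contraTneq (rank_leq_col (lin1_mx fl)).
  by move=> ->; rewrite -ltnNge.
case/rowV0Pn => v /sub_kermxP vker v0.
exists N, (cf v); split.
  apply/mpolyP => m; rewrite mcoeff0.
  have [mB|mB] := ltnP (mdeg m) B; last first.
    apply: memN_msupp_eq0; apply: msize_mdeg_ge.
    exact: leq_trans (digit_eval_deg _ _ hd) mB.
  have hm i : (m i < B)%N by apply: leq_ltn_trans mB; rewrite mdegE (bigD1 i) //= leq_addr.
  pose e : T := [ffun i => Ordinal (hm i)].
  have <- : mon e = m by apply/mnmP => i; rewrite mnmE ffunE.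
  have := congr1 (fun M : 'rV_#|T| => M 0 (enum_rank e)) vker.
  by rewrite mul_rV_lin1 !mxE /= enum_rankK.
have [j vj] : exists j, v 0 j != 0.
  apply/existsP; rewrite -negb_forall; apply: contra v0 => /forallP h.
  by apply/eqP/rowP => j; rewrite mxE; apply/eqP.
by exists j; split=> //; rewrite /cf valK.
Qed.

(** Going down the chain, an element of each prime outside the next smaller one extends a list that
    stays free; a list of [n.+1] elements would contradict [digit_dependent]. *)
Lemma prime_chain_leq_dim (P : {pred A}) h : prime_chain P h -> (h <= n)%N.
Proof.
case=> Q [pQ sQ _]; rewrite leqNgt; apply/negP => nh.
have free k : (k <= h)%N ->
    exists s : seq A, size s = k /\ forall N, digit_free (Q (h - k)%N) N s.
  elim: k => [|k IH] kh.
    (* At the top of the chain the empty list is free because a proper ideal contains no nonzero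
       constant. *)
    exists [::]; split=> // N c /=; rewrite subn0 => hc i; rewrite expn0.
    case: i => // _; apply/eqP; apply: contraTT hc => c0.
    apply: contra (prime1 (pQ h (leqnn _))) => cQ.
    have -> : 1 = (c 0%N)^-1%:MP * (c 0%N)%:MP :> A.
      by rewrite -mpolyCM mulVf.
    by apply: primeMr => //; apply: pQ.
  have [s [ss fs]] := IH (ltnW kh).
  have hk : (h - k.+1 < h)%N by lia.
  have hk1 : ((h - k.+1).+1 = h - k)%N by lia.
  have [sub nsub] := sQ _ hk; rewrite hk1 in sub nsub.
  have [q qQ qP] : exists2 q, q \in Q (h - k)%N & q \notin Q (h - k.+1)%N.
    apply: NNPP => nq; apply: nsub => q qQ; apply/negPn/negP => qP.
    by apply: nq; exists q.
  exists (q :: s); split=> [|N]; first by rewrite /= ss.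
  by apply: digit_free_cons (fs N) => //; apply: pQ; lia.
have [s [ss fs]] := free n.+1 nh.
have [|N [c [c0 [i [hi ci]]]]] := @digit_dependent s; first by rewrite ss.
move: ci; rewrite (fs N c) ?eqxx // c0; apply: prime0; apply: pQ; lia.
Qed.

End Dimension.

(** * Ideals generated by variables *)

Section Support.
Variables (K : fieldType) (n : nat).
Local Notation A := {mpoly K[n]}.
Implicit Types (S : pred 'X_{1..n}) (f g : A).

(** For upward closed [S] this is the monomial ideal spanned by the monomials in [S]; variable
    ideals and the edge ideal are both handled in this form. *)
Definition supported S : {pred A} := fun f => all S (msupp f).

Lemma supportedE S f : (f \in supported S) = all S (msupp f).
Proof. by []. Qed.

Lemma supportedP S f :
  reflect (forall m, f@_m != 0 -> S m) (f \in supported S).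
Proof.
apply: (iffP allP) => h m; first by rewrite -mcoeff_msupp; apply: h.
by rewrite mcoeff_msupp; apply: h.
Qed.

Lemma supported0 S : 0 \in supported S.
Proof. by apply/supportedP => m; rewrite mcoeff0 eqxx. Qed.

Lemma supportedD S f g :
  f \in supported S -> g \in supported S -> f + g \in supported S.
Proof.
move=> /supportedP fS /supportedP gS; apply/supportedP => m; apply: contraR => Sm.
rewrite mcoeffD.
have /eqP -> : f@_m == 0 by apply: contraR Sm; apply: fS.
have /eqP -> : g@_m == 0 by apply: contraR Sm; apply: gS.
by rewrite addr0.
Qed.

Lemma supportedMX S f m :
  (f * 'X_[m] \in supported S) = (f \in supported (fun k => S (k + m)%MM)).
Proof.
rewrite !supportedE (perm_all _ (msuppMX f m)) all_map.
by apply: eq_all => k /=; rewrite addmC.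
Qed.

Lemma supportedMr S f g : (forall m k, S m -> S (k + m)%MM) ->
  f \in supported S -> g * f \in supported S.
Proof.
move=> up /supportedP fS; rewrite (mpolyE f) mulr_sumr.
apply: (big_ind (fun h => h \in supported S)).
- exact: supported0.
- exact: supportedD.
move=> m _; have [->|fm] := eqVneq f@_m 0; first by rewrite scale0r mulr0 supported0.
rewrite -scalerAr scalerAl supportedMX; apply/supportedP => k _.
exact/up/fS.
Qed.

Definition restrict S f : A := \sum_(m <- msupp f | S m) f@_m *: 'X_[m].

Lemma restrict_coef S f m : (restrict S f)@_m = if S m then f@_m else 0.
Proof.
rewrite /restrict [LHS](raddf_sum (mcoeff m)) /=.
have eq0 k : k != m -> (f@_k *: 'X_[k] : A)@_m = 0.
  by move=> km; rewrite mcoeffZ mcoeffX (negPf km) mulr0.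
case: ifP => Sm; last first.
  by apply: big1 => k Sk; apply: eq0; apply: contraTneq Sk => ->; rewrite Sm.
have [fm|] := boolP (m \in msupp f); last first.
  move=> fm; rewrite (memN_msupp_eq0 fm) big_seq_cond; apply: big1 => k /andP[kf _].
  by apply: eq0; apply: contraTneq kf => ->.
rewrite big_mkcond (bigD1_seq m) //= Sm mcoeffZ mcoeffX eqxx mulr1.
rewrite big1 ?addr0 // => k km; case: ifP => // _; exact: eq0.
Qed.

Lemma restrict_supported S f : restrict S f \in supported S.
Proof. by apply/supportedP => m; rewrite restrict_coef; case: ifP => //; rewrite eqxx. Qed.

Lemma restrictC S f : f = restrict S f + restrict (predC S) f.
Proof.
apply/mpolyP => m; rewrite mcoeffD !restrict_coef /=.
by case: (S m); rewrite ?addr0 ?add0r.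
Qed.

End Support.

Lemma prime_chain_rcons (R : comNzRingType) (P Q : {pred R}) h :
  prime_chain P h -> prime_ideal Q ->
  {subset P <= Q} /\ ~ {subset Q <= P} -> prime_chain Q h.+1.
Proof.
case=> c [pc sc cP] pQ [PQ QP].
exists (fun i => if (i <= h)%N then c i else Q); split.
- by move=> i _ /=; case: ifP => // /pc.
- move=> i /=; rewrite ltnS; have [ih _|//|-> _] := ltngtP i h; first exact: sc.
  split=> [f|sub]; first by rewrite cP; apply: PQ.
  by apply: QP => f /sub; rewrite cP.
- by rewrite /= ltnn.
Qed.

Lemma prime_chain_eqi (R : comNzRingType) (P Q : {pred R}) h :
  P =i Q -> prime_chain P h -> prime_chain Q h.
Proof. by move=> PQ [c [pc sc cP]]; exists c; split=> // f; rewrite cP PQ. Qed.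

Section VariableIdeals.
Variables (K : fieldType) (V : finType).
Local Notation A := {mpoly K[#|V|]}.
Local Notation "m @ v" := (m (enum_rank v)) (at level 9, no associativity).
Implicit Types (C : {set V}) (v : V) (m : 'X_{1..#|V|}).

Definition meets C m : bool := [exists v in C, (0 < m@v)%N].

Definition var_ideal C : {pred A} := supported (meets C).

Lemma meets_mono C m k : meets C m -> meets C (k + m)%MM.
Proof.
case/exists_inP => v vC mv; apply/exists_inP; exists v => //.
by rewrite mnmDE ltn_addl.
Qed.

Lemma meetsD C m k : meets C (m + k)%MM = meets C m || meets C k.
Proof.
apply/idP/orP => [|[]]; last 2 first.
- by rewrite addmC; apply: meets_mono.
- exact: meets_mono.
case/exists_inP => v vC; rewrite mnmDE addn_gt0 => /orP[] h; [left|right];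
  by apply/exists_inP; exists v.
Qed.

Lemma meets1 C v : meets C U_(enum_rank v)%MM = (v \in C).
Proof.
apply/exists_inP/idP => [[u uC]|vC]; last by exists v; rewrite // mnm1E eqxx.
by rewrite mnm1E lt0b => /eqP/enum_rank_inj->.
Qed.

Lemma var_idealMr C f g : f \in var_ideal C -> g * f \in var_ideal C.
Proof. by apply: supportedMr => m k; apply: meets_mono. Qed.

(** Modulo the ideal, [u] and [v] can be replaced by their parts free of the variables in [C]. If
    both parts are nonzero, the leading monomial of their product is again free of [C]. *)
Lemma var_ideal_prime C : prime_ideal (R := vpoly K V) (var_ideal C).
Proof.
split; first split.
- exact: supported0.
- apply/supportedP => /(_ 0%MM); rewrite mcoeff1 eqxx oner_eq0 => /(_ isT).
  by case/exists_inP => v _; rewrite mnm0E.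
- move=> a u v uC vC; apply: supportedD vC; exact: var_idealMr.
move=> u v uvC; apply/negPn/negP; rewrite negb_or => /andP[uC vC].
pose lo (f : A) := restrict (predC (meets C)) f.
have lo0 f : f \notin var_ideal C -> lo f != 0.
  apply: contra => /eqP f0; rewrite (restrictC (meets C) f) [X in _ + X]f0 addr0.
  exact: restrict_supported.
have lolo : lo u * lo v \in var_ideal C.
  have hiC f : restrict (meets C) f \in var_ideal C by apply: restrict_supported.
  have split2 (a b c d : A) :
    b * d = (a + b) * (c + d) + (- (c + d)) * a + (- b) * c by ring.
  rewrite (split2 (restrict (meets C) u) _ (restrict (meets C) v)) -!restrictC.
  by rewrite !supportedD // var_idealMr.
move/supportedP: lolo => /(_ (mlead (lo u) + mlead (lo v))%MM).
rewrite -mleadM ?lo0 // mleadc_eq0 mulf_neq0 ?lo0 // => /(_ isT).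
rewrite mleadM ?lo0 // meetsD.
have nm f : f \notin var_ideal C -> ~~ meets C (mlead (lo f)).
  move=> fC; have /supportedP := restrict_supported (predC (meets C)) f.
  by apply; rewrite mleadc_eq0 lo0.
by rewrite !(negPf (nm _ _)).
Qed.

Lemma var_idealX C v : (vvar K v \in var_ideal C) = (v \in C).
Proof. by rewrite supportedE /vvar msuppX /= andbT meets1. Qed.

Lemma var_idealS C C' : C \subset C' -> {subset var_ideal C <= var_ideal C'}.
Proof.
move=> /subsetP CC' f /supportedP fC; apply/supportedP => m /fC.
by case/exists_inP => v /CC' vC' mv; apply/exists_inP; exists v.
Qed.

Lemma var_ideal_proper C C' :
  C \proper C' -> {subset var_ideal C <= var_ideal C'} /\
                  ~ {subset var_ideal C' <= var_ideal C}.
Proof.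
case/properP => CC' [v vC' vC]; split; first exact: var_idealS.
by move=> /(_ (vvar K v)); rewrite !var_idealX vC' (negPf vC) => /(_ isT).
Qed.

(** The variables of [C' :\: C] are adjoined one at a time. *)
Lemma var_ideal_chain C C' h : C \subset C' ->
  prime_chain (R := vpoly K V) (var_ideal C) h ->
  prime_chain (R := vpoly K V) (var_ideal C') (h + #|C' :\: C|).
Proof.
move hk: #|C' :\: C| => k; elim: k C' hk => [|k IH] C' hk CC' hC.
  suff <- : C = C' by rewrite addn0.
  by apply/eqP; rewrite eqEsubset CC' -setD_eq0 -cards_eq0 hk.
have [v] : exists v, v \in C' :\: C by apply/set0Pn; rewrite -cards_eq0 hk.
rewrite inE => /andP[vC vC'].
rewrite addnS; apply: (@prime_chain_rcons _ (var_ideal (C' :\ v))).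
- apply: IH => //; last by rewrite subsetD1 CC'.
  move: hk; rewrite (cardsD1 v) !inE vC vC' => -[<-].
  by apply: eq_card => u; rewrite !inE; case: (u == v); rewrite ?andbF.
- exact: var_ideal_prime.
- by apply: var_ideal_proper; rewrite properD1.
Qed.

(** A chain from the zero ideal gives the lower bound. For the upper bound, any chain ending here is
    prolonged by the variables outside [C] and its length compared with the number of all
    variables. *)
Lemma var_ideal_height C : has_height (R := vpoly K V) (var_ideal C) #|C|.
Proof.
split.
  have -> : #|C| = (0 + #|C :\: set0|)%N by rewrite setD0.
  apply: var_ideal_chain; first exact: sub0set.
  by exists (fun=> var_ideal set0); split=> // i _; apply: var_ideal_prime.
move=> k /(var_ideal_chain (subsetT C)) /prime_chain_leq_dim.
by rewrite setTD -[X in (_ <= X)%N](cardsC C) leq_add2r.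
Qed.
End VariableIdeals.

(** * Associated primes of edge ideals *)

Section EdgeIdeal.
Variables (K : fieldType) (V : finType) (D : wograph V).
Local Notation A := {mpoly K[#|V|]}.
Local Notation "m @ v" := (m (enum_rank v)) (at level 9, no associativity).
Implicit Types (C : {set V}) (v : V) (m : 'X_{1..#|V|}).

(** As the ends of an edge differ, this says that some generator divides the monomial. *)
Definition in_edge_ideal m : bool :=
  [exists p : V * V, [&& edge D p.1 p.2, (0 < m@(p.1))%N
                       & (weight D p.2 <= m@(p.2))%N]].

Lemma in_edge_idealP m :
  reflect (exists a b, [/\ edge D a b, (0 < m@a)%N & (weight D b <= m@b)%N])
          (in_edge_ideal m).
Proof.
apply: (iffP existsP) => [[[a b] /and3P[/= *]]|[a [b [ab ma mb]]]].
  by exists a, b.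
by exists (a, b); rewrite ab ma.
Qed.

Lemma in_edge_ideal_mono m k : in_edge_ideal m -> in_edge_ideal (k + m)%MM.
Proof.
case/in_edge_idealP => a [b [ab ma mb]]; apply/in_edge_idealP; exists a, b.
by rewrite !mnmDE; split=> //; [lia|apply: leq_trans mb _; exact: leq_addl].
Qed.

Lemma edge_neq a b : edge D a b -> a != b.
Proof. by move=> ab; apply/eqP => e; move: (edge_irr D a); rewrite {2}e ab. Qed.

Definition gen_exp (p : V * V) : 'X_{1..#|V|} :=
  (U_(enum_rank p.1) + U_(enum_rank p.2) *+ weight D p.2)%MM.

Lemma genE p : vvar K p.1 * vvar K p.2 ^+ weight D p.2 = 'X_[gen_exp p] :> A.
Proof. by rewrite /vvar mpolyXD mpolyXn. Qed.

Lemma mnm_var v u : (U_(enum_rank v) : 'X_{1..#|V|})%MM@u = (v == u) :> nat.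
Proof. by rewrite mnm1E (inj_eq enum_rank_inj). Qed.

Lemma gen_expE p v :
  (gen_exp p)@v = ((p.1 == v) + (p.2 == v) * weight D p.2)%N.
Proof. by rewrite mnmDE mulmnE !mnm_var. Qed.

Lemma edge_idealP f :
  @edge_ideal K V D f <-> (f : A) \in supported in_edge_ideal.
Proof.
split=> [[c ->]|fI].
  apply: (big_ind (fun h : A => h \in supported in_edge_ideal)).
  - exact: supported0.
  - exact: supportedD.
  move=> p pE; rewrite genE; apply: supportedMr; first exact: in_edge_ideal_mono.
  rewrite supportedE msuppX /= andbT; apply/in_edge_idealP; exists p.1, p.2.
  rewrite !gen_expE !eqxx (negPf (edge_neq pE)) eq_sym (negPf (edge_neq pE)).
  by rewrite mul1n.
have [I0 ID] : @edge_ideal K V D 0 /\ forall g h : vpoly K V,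
    edge_ideal D g -> edge_ideal D h -> edge_ideal D (g + h).
  split; first by exists (fun=> 0); rewrite big1 // => p _; rewrite mul0r.
  move=> g h [c ->] [d ->]; exists (fun p => c p + d p).
  by rewrite -big_split; apply: eq_bigr => p _; rewrite mulrDl.
rewrite [f](mpolyE f) big_seq; apply: (big_ind (fun h => @edge_ideal K V D h)) => //.
move=> m; move/supportedP: fI => fI; rewrite mcoeff_msupp => /fI.
case/in_edge_idealP => a [b [ab ma mb]]; pose g := gen_exp (a, b).
have gm : (g <= m)%MM.
  apply/mnm_lepP => i; rewrite -(enum_valK i) gen_expE /=.
  case: eqP => [<-|_]; first by rewrite eq_sym (negPf (edge_neq ab)).
  by case: eqP => [<-|_] //; rewrite mul1n.
exists (fun p => (p == (a, b))%:R * (f@_m *: 'X_[m - g])).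
rewrite (bigD1 (a, b)) //= eqxx mul1r big1 ?addr0; last first.
  by move=> p /andP[_ /negPf->]; rewrite !mul0r.
by rewrite (genE (a, b)) -scalerAl -mpolyXD submK.
Qed.

Definition exits C v : bool := [exists y, edge D v y && (y \notin C)].

Definition strong_cover C : bool :=
  [forall x, forall y, edge D x y ==> (x \in C) || (y \in C)] &&
  [forall v in C, [forall y, adj D v y ==> (y \in C)] ==>
     [exists y in C, [&& edge D y v, weight D y != 1%N & ~~ exits C y]]].

Lemma strong_coverP C :
  reflect ((forall x y, edge D x y -> (x \in C) || (y \in C)) /\
           (forall v, v \in C -> (forall y, adj D v y -> y \in C) ->
              exists y, [/\ y \in C, edge D y v, weight D y != 1%N & ~~ exits C y]))
          (strong_cover C).
Proof.
apply: (iffP andP) => -[h1 h2]; split.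
- by move=> x y; move/forallP/(_ x)/forallP/(_ y)/implyP: h1.
- move=> v vC vin; move/forall_inP/(_ v vC)/implyP: h2.
  case/(_ _)/exists_inP; first by apply/forallP => y; apply/implyP/vin.
  by move=> y yC /and3P[? ? ?]; exists y.
- by apply/forallP => x; apply/forallP => y; apply/implyP/h1.
apply/forall_inP => v vC; apply/implyP => /forallP vin.
have [|y [yC yv wy ye]] := h2 v vC; first by move=> y; apply/implyP/vin.
by apply/exists_inP; exists y; rewrite // yv wy.
Qed.

(** For a strong cover [C], the colon of I(D) by this monomial is generated by the variables of [C].
    Off [C] the exponents admit every edge; a vertex of [C] with an edge leaving [C] must then have
    exponent 0, and the other vertices of [C] stay just below their weight. *)
Definition witness C : 'X_{1..#|V|} :=
  [multinom let v := enum_val i in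
     if v \notin C then weight D v else if exits C v then 0%N else (weight D v).-1
   | i < #|V|].

Lemma witnessE C v : (witness C)@v =
  if v \notin C then weight D v else if exits C v then 0%N else (weight D v).-1.
Proof. by rewrite mnmE enum_rankK. Qed.

(** If the head of an edge is in [C], its exponent is below its weight; otherwise the tail is in [C]
    and exits, so its exponent is 0. *)
Lemma witness_notin C m : strong_cover C -> ~~ meets C m ->
  ~~ in_edge_ideal (m + witness C)%MM.
Proof.
case/strong_coverP => cov _ mC; apply/negP.
case/in_edge_idealP => a [b [ab]]; rewrite !mnmDE !witnessE.
have m0 v : v \in C -> m@v = 0%N.
  by move=> vC; apply/eqP; rewrite -leqn0 leqNgt; apply: contra mC => mv; apply/exists_inP; exists v.
have [bC _|bC] := boolP (b \in C).
  by rewrite m0 //= add0n; have := weight_gt0 D b; case: ifP; lia.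
have aC : a \in C by have := cov _ _ ab; rewrite (negPf bC) orbF.
rewrite (m0 a) // aC /=; suff -> : exits C a by [].
by apply/existsP; exists b; rewrite ab.
Qed.

(** A vertex that exits becomes the tail of a generator. Any other reaches its weight and needs an
    in-neighbour of positive exponent: one off [C] or, failing that, the one given by strongness,
    whose exponent is its weight minus one. *)
Lemma witness_in C v : strong_cover C -> v \in C ->
  in_edge_ideal (U_(enum_rank v) + witness C)%MM.
Proof.
case/strong_coverP => cov inn vC; apply/in_edge_idealP.
have wv := weight_gt0 D v.
have nvE u : (U_(enum_rank v) + witness C)%MM@u = ((v == u) + (witness C)@u)%N.
  by rewrite mnmDE mnm_var.
have [/existsP[b /andP[vb bC]]|nex] := boolP (exits C v).
  by exists v, b; rewrite !nvE eqxx !witnessE bC; split=> //; lia.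
have vw : (weight D v <= (U_(enum_rank v) + witness C)%MM@v)%N.
  by rewrite nvE eqxx witnessE vC (negPf nex) /=; lia.
have [h|h] := boolP [forall y, adj D v y ==> (y \in C)].
  have [|a [aC av wa ea]] := inn v vC; first by move=> y; apply/implyP/(forallP h).
  exists a, v; rewrite nvE witnessE aC (negPf ea) /=.
  by have := weight_gt0 D a; split=> //; lia.
move: h; rewrite negb_forall => /existsP[a]; rewrite negb_imply => /andP[va aC].
have av : edge D a v.
  case/orP: va => // va; case/negP: nex; apply/existsP; exists a; exact/andP.
by exists a, v; rewrite nvE witnessE aC; have := weight_gt0 D a; split=> //; lia.
Qed.

Lemma strong_cover_associated C : strong_cover C ->
  associated_prime (R := vpoly K V) (@edge_ideal K V D) (var_ideal (K := K) C).
Proof.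
move=> sC; split; first exact: var_ideal_prime.
exists ('X_[witness C] : A) => g; rewrite edge_idealP supportedMX.
split=> /supportedP h; apply/supportedP => m gm.
  have /exists_inP[v vC mv] := h m gm.
  have -> : m = (m - U_(enum_rank v) + U_(enum_rank v))%MM.
    by rewrite submK // lep1mP -lt0n.
  by rewrite -addmA; apply/in_edge_ideal_mono/witness_in.
apply: contraTT (h m gm); exact: witness_notin.
Qed.
End EdgeIdeal.

Lemma count_ltn (T : eqType) (a b : pred T) (s : seq T) x :
  subpred a b -> x \in s -> b x -> ~~ a x -> (count a s < count b s)%N.
Proof.
move=> ab xs bx ax.
elim: s xs => //= y s IH; rewrite inE => /predU1P[<-|/IH lt].
  by rewrite bx (negPf ax) add0n ltnS sub_count.
by have : (a y <= b y)%N; [case ay : (a y) => //; rewrite ab | lia].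
Qed.

(* Either X^(mlead g) kills f, or lies in P, or f can be replaced by
   f X^(mlead g), which has fewer terms outside the monomial ideal. *)
Lemma colon_mlead (K : fieldType) n (S : pred 'X_{1..n})
    (P : {pred {mpoly K[n]}}) (f g : {mpoly K[n]}) :
  (forall m k, S m -> S (k + m)%MM) -> prime_ideal P ->
  (forall h, h \in P <-> h * f \in supported S) ->
  g \in P -> g != 0 -> 'X_[mlead g] \in P.
Proof.
move=> up pP; have [N] := ubnP (count (predC S) (msupp f)).
elim: N f => // N IH f; rewrite ltnS => fN Pf gP g0.
pose f' := restrict (predC S) f.
have f'0 : f' != 0.
  apply: contra (prime1 pP) => /eqP f'0; apply/Pf.
  (* If [f'] vanished, [f] would be in the monomial ideal and 1 in [P]. *)
  rewrite mul1r (restrictC S f) [X in _ + X]f'0 addr0; exact: restrict_supported.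
have [mf' mS] : f@_(mlead f') != 0 /\ ~~ S (mlead f').
  have := mleadc_eq0 f'; rewrite (negPf f'0) restrict_coef /=.
  by case: (S _) => /=; rewrite ?eqxx // => ->.
have gS : S (mlead g + mlead f')%MM.
  have : g * f' \in supported S.
    have ef : f = restrict S f + f' := restrictC S f.
    have -> : g * f' = g * f + (- g) * restrict S f.
      by rewrite [X in g * X + _]ef; ring.
    apply: supportedD; first exact/Pf.
    by apply: supportedMr => //; apply: restrict_supported.
  move/supportedP; apply; rewrite -mleadM // mleadc_eq0 mulf_neq0 //.
apply/negPn/negP => gX; case/negP: (gX).
apply: (IH (f * 'X_[mlead g])) => //.
  apply: leq_trans fN; rewrite (permP (msuppMX f (mlead g))) count_map.
  (* The term of [f] at [mlead f'] moves into [S], and no term moves out. *)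
  apply: (@count_ltn _ _ _ _ (mlead f')); rewrite ?mcoeff_msupp //=.
    by move=> k /=; apply: contra => /up; apply.
  by rewrite negbK.
(* Since [P] is prime and avoids ['X_[mlead g]], the colon by the new polynomial is still [P]. *)
move=> h; rewrite mulrCA mulrC -Pf.
by rewrite (primeM pP) (negPf gX) orbF.
Qed.

Section AssociatedPrimes.
Variables (K : fieldType) (V : finType) (D : wograph V).
Local Notation A := {mpoly K[#|V|]}.
Local Notation "m @ v" := (m (enum_rank v)) (at level 9, no associativity).
Implicit Types (C : {set V}) (v : V) (m : 'X_{1..#|V|}).

(* As u is outside the ideal but maximal along C, its exponent at v in C is
   0 or w(v) - 1. *)
Lemma maximal_monomial_strong_cover C (u : 'X_{1..#|V|}) :
  ~~ in_edge_ideal D u ->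
  (forall v, v \in C -> in_edge_ideal D (U_(enum_rank v) + u)%MM) ->
  (forall v, v \notin C -> (weight D v <= u@v)%N) ->
  strong_cover D C.
Proof.
move=> uI uC unC.
have nI a b : edge D a b -> (0 < u@a)%N -> (u@b < weight D b)%N.
  move=> ab ua; rewrite ltnNge; apply: contra uI => ub.
  by apply/in_edge_idealP; exists a, b.
have upos v : v \notin C -> (0 < u@v)%N.
  by move=> /unC; apply: leq_trans; exact: weight_gt0.
(* The edge that brings the product with the variable [v] into the ideal has [v] as tail, with
   exponent 0 in [u], or as head, with exponent one below its weight. *)
have near v : v \in C ->
    (exists b, [/\ edge D v b, u@v = 0%N & (weight D b <= u@b)%N]) \/
    (exists a, [/\ edge D a v, (0 < u@a)%N & (weight D v = u@v + 1)%N]).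
  move=> /uC/in_edge_idealP[a [b [ab]]]; rewrite !mnmDE !mnm_var => ua ub.
  have := nI a b ab; have := edge_neq ab.
  have [va|va] := eqVneq v a; have [vb|vb] := eqVneq v b; subst=> //; move: ua ub;
    rewrite ?eqxx ?(negPf va) ?(negPf vb) /=.
  - by [].
  - move=> _ ub _ lt; left; exists b; split=> //.
    by apply/eqP; rewrite -leqn0 leqNgt; apply/negP => /lt; rewrite ltnNge ub.
  - move=> ua ub _ /(_ ua) h; right; exists a; split=> //; lia.
  - by move=> ua ub _ /(_ ua); lia.
have ult v : v \in C -> (u@v < weight D v)%N.
  by move=> /near[[b [_ -> _]]|[a [_ _ ->]]]; [exact: weight_gt0 | rewrite addn1].
apply/strong_coverP; split=> [x y xy|v vC vin].
  rewrite -[_ || _]negbK negb_or; apply: contra uI => /andP[xC yC].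
  by apply/in_edge_idealP; exists x, y; split; [|exact: upos|exact: unC].
(* The tail case is impossible: the head would lie in [C], where exponents stay below the
   weights. *)
case: (near v vC) => [[b [vb _ ub]]|[a [av ua _]]].
  by have := ult b (vin b _); rewrite ltnNge ub /adj vb => /(_ isT).
have aC : a \in C by apply: vin; rewrite /adj av orbT.
exists a; split=> //; first by apply/eqP => wa; have := ult a aC; rewrite wa; lia.
apply/existsP => -[y /andP[ay yC]]; have := nI a y ay ua.
by rewrite ltnNge unC.
Qed.

(** By [colon_mlead] the prime is spanned by monomials, hence generated by the variables it
    contains; strongness of this set is then read off one monomial outside the edge ideal. *)
Lemma associated_var_ideal (P : {pred A}) :
  associated_prime (R := vpoly K V) (@edge_ideal K V D) P ->
  exists2 C, strong_cover D C & P =i var_ideal (K := K) C.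
Proof.
case=> pP [f Pf'].
have Pf (h : A) : h \in P <-> h * f \in supported (in_edge_ideal D).
  by rewrite Pf' edge_idealP.
have PX (g : A) : g \in P -> g != 0 -> ('X_[mlead g] : A) \in P.
  by apply: (colon_mlead _ pP Pf); apply: in_edge_ideal_mono.
pose C := [set v | vvar K v \in P].
have meetsP m : (('X_[m] : A) \in P) = meets C m.
  apply/idP/exists_inP => [|[v]]; last first.
    rewrite inE => vP mv.
    have -> : m = (m - U_(enum_rank v) + U_(enum_rank v))%MM.
      by rewrite submK // lep1mP -lt0n.
    by rewrite mpolyXD; apply: primeMr.
  rewrite mpolyXE_id => XP; apply: NNPP => nC.
  move: XP; apply/negP; elim/big_ind: _ => [|g h gP hP|i _].
  - exact: (prime1 pP).
  - by rewrite (primeM pP) negb_or gP.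
  have [->|mi] := posnP (m i); first by rewrite expr0 (prime1 pP).
  apply/negP => /(primeX pP) XiP; apply: nC; exists (enum_val i).
    by rewrite inE /vvar enum_valK.
  by rewrite enum_valK.
have PC : P =i var_ideal C.
  move=> g; apply/idP/idP => [|/supportedP gC]; last first.
    rewrite (mpolyE g); apply: (prime_sum pP) => m _.
    have [->|gm] := eqVneq g@_m 0; first by rewrite scale0r (prime0 pP).
    by rewrite -mul_mpolyC; apply: (primeMr pP); rewrite meetsP gC.
  (* The leading term lies in [P] and is subtracted, which lowers the number of terms. *)
  have [N] := ubnP (size (msupp g)); elim: N g => // N IH g gN gP.
  have [->|g0] := eqVneq g 0; first exact: supported0.
  have gl := PX g gP g0.
  pose t := g@_(mlead g) *: 'X_[mlead g] : A.
  have tP : t \in P by rewrite /t -mul_mpolyC; apply: (primeMr pP).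
  rewrite -(subrK t g); apply: supportedD.
    apply: IH; last exact: (primeB pP).
    rewrite (perm_size (msupp_rem g (mlead g))) size_rem ?mlead_supp //.
    by move: gN g0; rewrite -msupp_eq0 -size_eq0; case: size.
  apply/supportedP => m; rewrite mcoeffZ mcoeffX.
  by have [<- _|_] := eqVneq (mlead g) m; rewrite ?mulr0 ?eqxx // -meetsP.
exists C => //.
(* The monomial with exponent [W] off [C] and 0 on [C] is not in [P], so its product with some term
   of [f] stays outside the edge ideal; that product meets the conditions of
   [maximal_monomial_strong_cover]. *)
pose W := (\max_(v : V) weight D v)%N.
pose k : 'X_{1..#|V|} := [multinom if enum_val i \in C then 0%N else W | i < #|V|].
have kE v : k@v = if v \in C then 0%N else W by rewrite mnmE enum_rankK.
have : ('X_[k] : A) \notin P.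
  rewrite meetsP; apply/exists_inP => -[v vC]; by rewrite kE vC.
move=> kP; have [fX|] := boolP (('X_[k] : A) * f \in supported (in_edge_ideal D)).
  by case/negP: kP; apply/Pf.
rewrite mulrC supportedMX supportedE => /allPn[m fm mk].
apply: (maximal_monomial_strong_cover mk) => v vC.
  rewrite addmA addmC; apply/in_edge_ideal_mono.
  have : vvar K v \in P by rewrite PC var_idealX.
  move=> /Pf; rewrite mulrC supportedMX => /supportedP h; rewrite addmC; apply: h.
  by rewrite -mcoeff_msupp.
by rewrite mnmDE kE (negPf vC); apply: leq_trans (leq_addl _ _); apply: leq_bigmax.
Qed.
End AssociatedPrimes.

(** * Strong vertex covers of oriented cycles *)

Theorem unmixed_strong_covers (K : fieldType) (V : finType) (D : wograph V) :
  unmixed (@edge_ideal K V D) <->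
  exists h, forall C, strong_cover D C -> #|C| = h.
Proof.
split=> -[h hh]; exists h.
  move=> C /(strong_cover_associated K)/hh [Ch hC].
  have [Cc cC] := var_ideal_height K C.
  by apply/eqP; rewrite eqn_leq hC ?cC.
move=> P /associated_var_ideal[C /hh <- PC].
have [Cc cC] := var_ideal_height K C.
have CP : var_ideal C =i P by move=> f; rewrite PC.
split; first exact: prime_chain_eqi Cc.
by move=> k /(prime_chain_eqi PC)/cC.
Qed.

Local Open Scope nat_scope.

(* Vertices are numbered along the cycle: O#i says that the edge {i, i+1} is
   oriented from i to i+1, P#i that i has weight <> 1, C#i that i is in C. *)
Section Bits.
Variable n : nat.

Definition csucc i := i.+1 %% n.
(** Adding [n.-1] avoids truncated subtraction at 0. *)
Definition cpred i := (i + n.-1) %% n.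

Variables (O P C : seq bool).
Local Notation "s # i" := (nth false s i) (at level 9, i at level 9).

Definition edge_bits i j := (j == csucc i) && O#i || (i == csucc j) && ~~ O#j.

Definition exits_bits i := O#i && ~~ C#(csucc i) || ~~ O#(cpred i) && ~~ C#(cpred i).

Definition cover_bits := all (fun i => C#i || C#(csucc i)) (iota 0 n).

(** The two disjuncts are the two possible in-neighbours of [i]; their membership in [C] comes from
    the premise. *)
Definition strong_bits := cover_bits &&
  all (fun i => [&& C#i, C#(csucc i) & C#(cpred i)] ==>
         [&& O#(cpred i), P#(cpred i) & ~~ exits_bits (cpred i)] ||
         [&& ~~ O#i, P#(csucc i) & ~~ exits_bits (csucc i)]) (iota 0 n).

Definition sinks_bits := all (fun i => P#i ==> O#(cpred i) && ~~ O#i) (iota 0 n).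

Definition sources_bits := all (fun i => O#i && ~~ O#(cpred i) ==> ~~ P#i) (iota 0 n).
End Bits.

Fixpoint bits n : seq (seq bool) :=
  if n is m.+1 then map (cons true) (bits m) ++ map (cons false) (bits m)
  else [:: [::]].

Lemma mem_bits n s : (s \in bits n) = (size s == n).
Proof.
elim: n s => [|n IH] [|b s] //=; rewrite ?inE // mem_cat.
  by apply/negbTE; rewrite negb_or; apply/andP; split; apply/mapP => -[].
have inj c : injective (cons c : seq bool -> _) by move=> ? ? [].
have mem c : ((b :: s) \in map (cons c) (bits n)) = (b == c) && (size s == n).
  apply/mapP/andP => [[t tn [-> ->]]|[/eqP-> sn]]; first by rewrite -IH.
  by exists s; rewrite // IH.
by rewrite !mem eqSS -andb_orl; case: (b).
Qed.

Definition cover_sizes n O P :=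
  [seq count id C | C <- bits n & strong_bits n O P C].

Definition unmixed_bits n O P : bool := constant (cover_sizes n O P).

(** * Translation between an oriented cycle and its bit lists *)

Section Cycle.
Variables (V : finType) (D : wograph V) (n : nat) (y : nat -> V).

(* y enumerates the vertices along the cycle; only its values below n matter. *)
Definition enumerates_cycle : Prop :=
  [/\ 2 < n, forall v, exists2 i, i < n & y i = v,
      {in gtn n &, injective y}
    & {in gtn n &, forall i j, adj D (y i) (y j) = (j == csucc n i) || (i == csucc n j)}].

Hypothesis hy : enumerates_cycle.
Local Notation "s # i" := (nth false s i) (at level 9, i at level 9).

Definition orientation := mkseq (fun i => edge D (y i) (y (csucc n i))) n.
Definition nontrivial := mkseq (fun i => weight D (y i) != 1) n.
Definition member_bits (C : {set V}) := mkseq (fun i => y i \in C) n.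

Lemma csucc_lt i : csucc n i < n.
Proof. by rewrite ltn_mod; case: hy => /ltnW/ltnW. Qed.

Lemma cpred_lt i : cpred n i < n.
Proof. by rewrite ltn_mod; case: hy => /ltnW/ltnW. Qed.

Lemma csuccE i : i < n -> csucc n i = if i.+1 == n then 0 else i.+1.
Proof.
by move=> hi; rewrite /csucc; case: eqP => [->|]; rewrite ?modnn // => ?; rewrite modn_small; lia.
Qed.

Lemma cpredE i : i < n -> cpred n i = if i == 0 then n.-1 else i.-1.
Proof.
move=> hi; rewrite /cpred; case: eqP => [->|i0]; first by rewrite add0n modn_small; lia.
have -> : i + n.-1 = i.-1 + n by lia.
by rewrite modnDr modn_small; lia.
Qed.

Lemma csucc_eq i j : i < n -> j < n -> (i == csucc n j) = (j == cpred n i).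
Proof.
move=> hi hj; rewrite csuccE // cpredE //; apply/eqP/eqP;
  case: eqP => ?; case: eqP => ?; lia.
Qed.

Lemma orientationE i : i < n -> orientation#i = edge D (y i) (y (csucc n i)).
Proof. by move=> hi; rewrite nth_mkseq. Qed.

Lemma nontrivialE i : i < n -> nontrivial#i = (weight D (y i) != 1).
Proof. by move=> hi; rewrite nth_mkseq. Qed.

Lemma member_bitsE C i : i < n -> (member_bits C)#i = (y i \in C).
Proof. by move=> hi; rewrite nth_mkseq. Qed.

Lemma edge_asymE u v : adj D u v -> edge D u v = ~~ edge D v u.
Proof.
rewrite /adj; case uv : (edge D u v); first by rewrite (edge_asym uv).
by move=> /= ->.
Qed.

Lemma adj_csucc i : i < n -> adj D (y i) (y (csucc n i)).
Proof. by move=> hi; case: hy => _ _ _ ->; rewrite ?inE ?csucc_lt ?eqxx. Qed.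

Lemma edge_bitsE i j : i < n -> j < n ->
  edge D (y i) (y j) = edge_bits n orientation i j.
Proof.
move=> hi hj; rewrite /edge_bits !orientationE //.
have [_ _ _ hadj] := hy.
have n3 : 2 < n by case: hy.
have [->|ji] := eqVneq j (csucc n i) => /=.
  (* As [n] is at least 3, two steps along the cycle do not return to the start, so only one clause
     of [edge_bits] applies. *)
  have -> : (i == csucc n (csucc n i)) = false.
    rewrite [csucc n i]csuccE //; case: (eqVneq i.+1 n) => in1.
      by rewrite csuccE; [case: ifP; lia|lia].
    by rewrite csuccE; [case: ifP; lia|lia].
  by rewrite orbF.
have [->|ij] := eqVneq i (csucc n j) => /=.
  by apply: edge_asymE; rewrite /adj orbC; apply: adj_csucc.
have := hadj i j hi hj; rewrite (negPf ij) (negPf ji) /adj.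
by move/negbT; rewrite negb_or => /andP[/negbTE].
Qed.

Lemma edge_csucc i : i < n -> edge D (y (csucc n i)) (y i) = ~~ orientation#i.
Proof.
by move=> hi; rewrite orientationE // edge_asymE // /adj orbC; apply: adj_csucc.
Qed.

Lemma cpredK i : i < n -> csucc n (cpred n i) = i.
Proof. by move=> hi; apply/esym/eqP; rewrite csucc_eq ?cpred_lt. Qed.

Lemma edge_cpred i : i < n -> edge D (y (cpred n i)) (y i) = orientation#(cpred n i).
Proof. by move=> hi; rewrite orientationE ?cpred_lt // cpredK. Qed.

Lemma edge_to_cpred i : i < n -> edge D (y i) (y (cpred n i)) = ~~ orientation#(cpred n i).
Proof. by move=> hi; rewrite -{1}(cpredK hi) edge_csucc ?cpred_lt. Qed.

Lemma neighbours i v : i < n -> adj D (y i) v -> v = y (csucc n i) \/ v = y (cpred n i).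
Proof.
move=> hi; have [_ hs _ hadj] := hy; have [j hj <-] := hs v.
rewrite hadj // => /orP[/eqP->|]; first by left.
by rewrite csucc_eq // => /eqP->; right.
Qed.

Lemma exitsE C i : i < n ->
  exits D C (y i) = exits_bits n orientation (member_bits C) i.
Proof.
move=> hi; rewrite /exits_bits !member_bitsE ?csucc_lt ?cpred_lt //.
rewrite orientationE // -edge_to_cpred //.
apply/existsP/orP => [[v /andP[iv vC]]|[] /andP[e eC]]; last 2 first.
- by exists (y (csucc n i)); rewrite e.
- by exists (y (cpred n i)); rewrite e.
have [e|e] := @neighbours i v hi (introT orP (or_introl iv)); subst v;
  by [left; rewrite iv|right; rewrite iv].
Qed.

Lemma strong_coverE C :
  strong_cover D C = strong_bits n orientation nontrivial (member_bits C).
Proof.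
have [_ hs _ hadj] := hy.
have nl := csucc_lt; have pl := cpred_lt.
have adjP i : i < n -> adj D (y i) (y (cpred n i)).
  by move=> hi; rewrite -{1}(cpredK hi) /adj orbC; apply: adj_csucc.
have crit i : i < n ->
    [&& orientation#(cpred n i), nontrivial#(cpred n i)
      & ~~ exits_bits n orientation (member_bits C) (cpred n i)] ||
    [&& ~~ orientation#i, nontrivial#(csucc n i)
      & ~~ exits_bits n orientation (member_bits C) (csucc n i)] <->
    exists a, [/\ edge D a (y i), weight D a != 1 & ~~ exits D C a].
  move=> hi; rewrite !nontrivialE // -!exitsE // -edge_cpred // -edge_csucc //.
  split=> [/orP[]/and3P[]|[a [ai wa ea]]]; [by exists (y (cpred n i))|by exists (y (csucc n i))|].
  have [e|e] := @neighbours i a hi (introT orP (or_intror ai)); subst a;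
    by rewrite ai wa ea ?orbT.
apply/strong_coverP/andP => [[cov inn]|[/allP cov /allP inn]].
  split; apply/allP => i; rewrite mem_iota add0n /= => hi; rewrite !member_bitsE //.
    have := adj_csucc hi; rewrite /adj => /orP[/cov //|/cov]; by rewrite orbC.
  apply/implyP => /and3P[iC nC pC]; apply/crit => //.
  have [|a [_ ? ? ?]] := inn (y i) iC; last by exists a.
  by move=> v /(neighbours hi)[]->.
split=> [u v uv|v vC vin].
  have [i hi iu] := hs u; have [j hj jv] := hs v; subst u v.
  move: uv; rewrite edge_bitsE // /edge_bits.
  have := cov i; have := cov j; rewrite !mem_iota !add0n /= => /(_ hj) + /(_ hi).
  rewrite !member_bitsE // => cj ci.
  by case/orP => /andP[/eqP e _]; rewrite e // orbC.
have [i hi iv] := hs v; subst v.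
have := inn i; rewrite mem_iota add0n /= => /(_ hi).
rewrite !member_bitsE // vC !vin ?adj_csucc ?adjP //= => /crit[] // a [ai wa ea].
by exists a; split=> //; apply: vin; rewrite /adj ai orbT.
Qed.

Lemma card_member_bits (C : {set V}) : #|C| = count id (member_bits C).
Proof.
have [_ hs hinj _] := hy.
rewrite count_map -size_filter -(size_map y) cardE; apply/perm_size/uniq_perm.
- exact: enum_uniq.
- rewrite map_inj_in_uniq ?filter_uniq ?iota_uniq // => i j.
  by rewrite !mem_filter !mem_iota !add0n => /and3P[_ _ hi] /and3P[_ _ hj]; apply: hinj.
move=> v; rewrite mem_enum; apply/idP/mapP => [vC|[i]].
  have [i hi iv] := hs v; exists i => //.
  by rewrite mem_filter mem_iota add0n /= iv vC.
by rewrite mem_filter => /andP[/= iC _] ->.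
Qed.

Lemma member_bits_surj c : size c = n -> exists C, member_bits C = c.
Proof.
have [_ hs hinj _] := hy; move=> cn.
exists [set v | [exists i : 'I_n, (y i == v) && c#i]].
apply: (@eq_from_nth _ false) => [|i]; rewrite size_mkseq // => hi.
rewrite member_bitsE // inE; apply/existsP/idP => [[j /andP[/eqP ji cj]]|ci].
  by rewrite -(hinj j i _ _ ji) // inE.
by exists (Ordinal hi); rewrite eqxx.
Qed.

(** Strong covers correspond to the bit lists searched by [cover_sizes]. The left side does not
    mention the enumeration, so the bit test carries over from one enumeration to another. *)
Lemma unmixed_bitsP (K : fieldType) :
  unmixed (@edge_ideal K V D) <-> unmixed_bits n orientation nontrivial.
Proof.
rewrite unmixed_strong_covers /unmixed_bits /cover_sizes.
set l := map _ _.
have memP k : k \in l <-> exists2 C, strong_cover D C & #|C| = k.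
  split=> [/mapP[c]|[C sC <-]].
    rewrite mem_filter mem_bits => /andP[sc /eqP/member_bits_surj[C Cc]] ->.
    by exists C; rewrite ?strong_coverE ?card_member_bits Cc.
  apply/mapP; exists (member_bits C); last exact: card_member_bits.
  by rewrite mem_filter mem_bits size_mkseq eqxx andbT -strong_coverE.
split=> [[h hh]|].
  have lh k : k \in l -> k = h by case/memP => C /hh -> ->.
  have : all (pred1 h) l by apply/allP => k /lh->; apply/eqP.
  by case: (l) => //= a s /andP[/eqP ->].
case: l memP => [|a s] memP.
  by exists 0 => C sC; have := (memP #|C|).2 (ex_intro2 _ _ C sC erefl).
move=> /allP as_; exists a => C sC.
have := (memP #|C|).2 (ex_intro2 _ _ C sC erefl).
by rewrite inE => /predU1P[->//|/as_/eqP].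
Qed.

Lemma sourcesE : (forall v, source D v -> weight D v = 1) ->
  sources_bits n orientation nontrivial.
Proof.
move=> hsrc; apply/allP => i; rewrite mem_iota add0n /= => hi.
apply/implyP => /andP[oi op]; rewrite nontrivialE // negbK; apply/eqP/hsrc.
apply/forallP => v; apply/negP => vi.
have [e|e] := @neighbours i v hi (introT orP (or_intror vi)); subst v; move: vi.
  by rewrite edge_csucc // oi.
by rewrite edge_cpred // (negPf op).
Qed.

Lemma sinksE : sinks_bits n orientation nontrivial <->
  (forall v, v \in Vplus D -> sink D v).
Proof.
have [_ hs _ _] := hy; split=> [/allP h v|h].
  have [i hi <-] := hs v; rewrite inE => wi.
  have := h i; rewrite mem_iota add0n /= nontrivialE // wi => /(_ hi) /andP[op oi].
  apply/forallP => u; apply/negP => iu.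
  have [e|e] := @neighbours i u hi (introT orP (or_introl iu)); subst u; move: iu.
    by rewrite -orientationE // (negPf oi).
  by rewrite edge_to_cpred // op.
apply/allP => i; rewrite mem_iota add0n /= => hi; rewrite nontrivialE //.
apply/implyP => wi; have sk u : ~~ edge D (y i) u.
  by move: u; apply/forallP/h; rewrite inE.
by rewrite (orientationE hi) sk andbT -[_#_]negbK -edge_to_cpred.
Qed.

End Cycle.

(** The labelling is extended to all naturals by [inord], so that positions become plain numbers fit
    for computation. *)
Lemma cycle_labelling_enumerates n (V : finType) (D : wograph V) (x : 'I_n -> V) :
  2 < n -> cycle_labelling D x ->
  exists2 y, enumerates_cycle D n y & forall i : 'I_n, y i = x i.
Proof.
case: n x => // n x n2 [[z xz zx] hadj].
have yE (i : 'I_n.+1) : x (inord i) = x i by rewrite inord_val.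
exists (fun i => x (inord i)) => //; split=> //.
- by move=> v; exists (z v) => //; rewrite inord_val.
- move=> i j hi hj /(can_inj xz) e.
  by rewrite -(@inordK n i) // e inordK.
- by move=> i j hi hj; rewrite hadj /cycle_adj !inordK.
Qed.

(** * Minimal covers and cycles that are not well covered *)

Section BitLemmas.
Local Notation "s # i" := (nth false s i) (at level 9, i at level 9).
Variable n : nat.
Implicit Types O P C : seq bool.

(** A vertex can be removed from a cover exactly when both its neighbours are in the cover. *)
Definition minimal_bits C := cover_bits n C &&
  all (fun i => ~~ [&& C#i, C#(csucc n i) & C#(cpred n i)]) (iota 0 n).

Lemma minimal_strong_bits O P C : minimal_bits C -> strong_bits n O P C.
Proof.
case/andP => cov /allP min; rewrite /strong_bits cov; apply/allP => i hi.
by rewrite (negPf (min i hi)).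
Qed.

(** A vertex whose neighbours are all in the cover would need an in-neighbour of weight <> 1, but
    vertices of such weight are sinks. *)
Lemma sinks_strong_minimal O P C :
  sinks_bits n O P -> strong_bits n O P C -> minimal_bits C.
Proof.
move=> /allP sk /andP[cov /allP str]; rewrite /minimal_bits cov /=.
apply/allP => i hi; apply/negP => inner; have := str i hi; rewrite inner /=.
move: hi; rewrite mem_iota add0n /= => hi.
have pn : cpred n i \in iota 0 n by rewrite mem_iota add0n /= ltn_mod; lia.
have nn : csucc n i \in iota 0 n by rewrite mem_iota add0n /= ltn_mod; lia.
have nK : cpred n (csucc n i) = i.
  apply/esym/eqP; rewrite -csucc_eq //; move: nn; rewrite mem_iota add0n //.
case/orP => /and3P[].
  by move=> op pp _; have := sk _ pn; rewrite pp op andbF.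
by move=> oi pp _; have := sk _ nn; rewrite pp nK (negPf oi).
Qed.

(** More vertices of weight <> 1 only give more candidates for the in-neighbour; the heptagon can
    thus be checked with a single such vertex. *)
Lemma strong_bits_mono O P P' C :
  (forall i, P#i -> P'#i) -> strong_bits n O P C -> strong_bits n O P' C.
Proof.
move=> PP /andP[cov /allP str]; rewrite /strong_bits cov; apply/allP => i hi.
apply/implyP => /(implyP (str i hi)) /orP[] /and3P[a b c]; apply/orP; [left|right];
  by rewrite a PP.
Qed.

Lemma unmixed_count O P C C' : unmixed_bits n O P ->
  size C = n -> size C' = n -> strong_bits n O P C -> strong_bits n O P C' ->
  count id C = count id C'.
Proof.
move=> u hC hC' sC sC'.
have mem B : size B = n -> strong_bits n O P B -> count id B \in cover_sizes n O P.
  by move=> hB sB; apply: map_f; rewrite mem_filter sB mem_bits hB eqxx.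
move: u (mem _ hC sC) (mem _ hC' sC'); rewrite /unmixed_bits.
case: (cover_sizes _ _ _) => //= a s /allP h.
have eqa k : k \in a :: s -> k = a by rewrite inE => /predU1P[|/h/eqP].
by move=> /eqa-> /eqa->.
Qed.

Lemma unmixed_minimal O P k : sinks_bits n O P ->
  all (fun C => minimal_bits C ==> (count id C == k)) (bits n) ->
  unmixed_bits n O P.
Proof.
move=> sk /allP h; rewrite /unmixed_bits.
have : all (pred1 k) (cover_sizes n O P).
  apply/allP => _ /mapP[C + ->]; rewrite mem_filter => /andP[sC Cn].
  by apply: (implyP (h C Cn)); apply: sinks_strong_minimal sk sC.
by case: (cover_sizes n O P) => //= a s /andP[/eqP->].
Qed.

(* Two maximal independent sets: {0, 2, 4} and {0, 3} extended by the same
   vertices 6, 8, 10, ... <= n - 2. *)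
Lemma cycle_not_well_covered O P : 6 <= n -> n != 7 -> ~~ unmixed_bits n O P.
Proof.
move=> n6 n7; apply/negP => u.
pose f i := odd i || (n.-2 < i).
(* For [n = 7] this cover is not minimal, since 4, 5 and 6 all belong to it. *)
pose g (i : nat) := [&& i != 0, i != 3 & [|| odd i, i < 6 | n.-2 < i]].
have min (c : nat -> bool) :
    (forall i, i < n -> c i || c (if i.+1 == n then 0 else i.+1)) ->
    ~~ [&& c 0, c 1 & c n.-1] ->
    (forall i, i.+1 < n -> ~~ [&& c i.+1, c (if i.+2 == n then 0 else i.+2) & c i]) ->
    minimal_bits (mkseq c n).
  move=> cov inn0 inn; apply/andP; split; apply/allP => i; rewrite mem_iota add0n /= => hi.
    by rewrite csuccE // !nth_mkseq ?cov //; case: eqP; lia.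
  rewrite csuccE // cpredE //; case: i hi => [|i] hi /=.
    by rewrite (negPf (_ : 1 != n)) ?nth_mkseq //; lia.
  by rewrite !nth_mkseq ?inn //; [lia | case: eqP; lia].
have fE : [/\ f 0 = false, f 1 & [/\ f 2 = false, f 3, f 4 = false & f 5]].
  by rewrite /f /=; split; [lia|lia|split; lia].
have gE : [/\ g 0 = false, g 1 & [/\ g 2, g 3 = false, g 4 & g 5]].
  by rewrite /g /=; split; [lia|lia|split; lia].
(* The covers agree from position 6 on; among the first six positions [f] has three vertices and [g]
   four. *)
have cnt (c : nat -> bool) : count id (mkseq c n) =
    c 0 + (c 1 + (c 2 + (c 3 + (c 4 + c 5)))) + count c (iota 6 (n - 6)).
  have -> : mkseq c n = map c (iota 0 6 ++ iota 6 (n - 6)).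
    by rewrite -(iotaD 0 6) subnKC.
  by rewrite count_map count_cat /= addn0.
have : count id (mkseq f n) = count id (mkseq g n).
  apply: (unmixed_count u); rewrite ?size_mkseq //;
    apply/minimal_strong_bits/min => [i hi||i hi]; rewrite ?/f ?/g.
  - by case: (i.+1 =P n); lia.
  - by rewrite /=; lia.
  - by case: (i.+2 =P n); rewrite /=; lia.
  - by case: (i.+1 =P n); lia.
  - by rewrite /=; lia.
  - by case: (i.+2 =P n); rewrite /=; lia.
rewrite !cnt (@eq_in_count _ g f (iota 6 (n - 6))); last first.
  by case=> [|[|[|[|[|[|i]]]]]]; rewrite mem_iota.
by case: fE => -> -> [-> -> -> ->]; case: gE => -> -> [-> -> -> ->]; move/eqP; rewrite eqn_add2r.
Qed.

End BitLemmas.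

(** * The cycles of length 3, 4, 5 and 7 *)

Section FiveCycles.
Local Notation "s # i" := (nth false s i) (at level 9, i at level 9).
Variables O P : seq bool.
Local Notation e := (edge_bits 5 O).
Definition index5 : Type := nat * nat * nat * nat * nat.

Definition D1_bits (s : index5) := let: (a, b, c, d, f) := s in
  [&& e b a, e f a, e d f, e d c & e c b] &&
  [&& ~~ P#a, ~~ P#b, ~~ P#d, P#c & P#f].

Definition D2_bits (s : index5) := let: (a, b, c, d, f) := s in
  [&& e c b, e b a & e a f] && [&& P#a, P#b, ~~ P#c, ~~ P#d & ~~ P#f].

Definition D3_bits (s : index5) := let: (a, b, c, d, f) := s in
  [&& e a f, e f d & e d c] && [&& ~~ P#a, ~~ P#b, P#c, P#d & P#f].

Definition D4_bits (s : index5) := let: (a, b, c, d, f) := s in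
  [&& e a b, e b c, e d c & e d f] && [&& ~~ P#a, ~~ P#d, P#b, P#c & P#f].

(** The ten automorphisms of the 5-cycle, that is, each starting point with each direction. *)
Definition dihedral5 : seq index5 :=
  [:: (0,1,2,3,4); (1,2,3,4,0); (2,3,4,0,1); (3,4,0,1,2); (4,0,1,2,3);
      (0,4,3,2,1); (1,0,4,3,2); (2,1,0,4,3); (3,2,1,0,4); (4,3,2,1,0)].

Definition trivial_edge := has (fun i => ~~ P#i && ~~ P#(csucc 5 i)) (iota 0 5).

Definition excluded5 :=
  [|| has D1_bits dihedral5, has D2_bits dihedral5 | has D3_bits dihedral5].

Definition five_check :=
  let u := unmixed_bits 5 O P in
  [&& u ==> [|| sinks_bits 5 O P, trivial_edge | has D4_bits dihedral5],
      excluded5 ==> ~~ u, has D4_bits dihedral5 ==> u, sinks_bits 5 O P ==> u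
    & trivial_edge && ~~ excluded5 ==> u].

End FiveCycles.

(** Weights enter only through being 1 or not, so all cases are among the 32 orientations with the
    32 choices of V^+. *)
Lemma five_checkP O P : size O = 5 -> size P = 5 -> sources_bits 5 O P ->
  five_check O P.
Proof.
have : all (fun O => all (fun P => sources_bits 5 O P ==> five_check O P)
         (bits 5)) (bits 5) by vm_compute.
move=> /allP h hO hP; have /allP h' := h O (etrans (mem_bits _ _) (introT eqP hO)).
exact/implyP/h'/(etrans (mem_bits _ _) (introT eqP hP)).
Qed.

Lemma unmixed_triangle O P : size O = 3 -> size P = 3 -> sources_bits 3 O P ->
  unmixed_bits 3 O P = has negb P.
Proof.
have : all (fun O => all (fun P => sources_bits 3 O P ==>
   (unmixed_bits 3 O P == has negb P)) (bits 3)) (bits 3) by vm_compute.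
move=> /allP h hO hP; have /allP h' := h O (etrans (mem_bits _ _) (introT eqP hO)).
by move=> src; apply/eqP; move: src; exact/implyP/h'/(etrans (mem_bits _ _) (introT eqP hP)).
Qed.

Lemma unmixed_square O P : size O = 4 -> size P = 4 -> sources_bits 4 O P ->
  unmixed_bits 4 O P = sinks_bits 4 O P.
Proof.
have : all (fun O => all (fun P => sources_bits 4 O P ==>
   (unmixed_bits 4 O P == sinks_bits 4 O P)) (bits 4)) (bits 4) by vm_compute.
move=> /allP h hO hP; have /allP h' := h O (etrans (mem_bits _ _) (introT eqP hO)).
by move=> src; apply/eqP; move: src; exact/implyP/h'/(etrans (mem_bits _ _) (introT eqP hP)).
Qed.

(* If i is not a sink and w(i) <> 1, let a be its in-neighbour: the set of
   vertices other than a and the vertex opposite to the edge {a, i} is a strong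
   cover of size 5, while C_7 has minimal covers of size 4. *)
Definition heptagon_cover (O : seq bool) i :=
  let a := if nth false O i then cpred 7 i else csucc 7 i in
  let b := if nth false O i then (i + 3) %% 7 else (i + 4) %% 7 in
  mkseq (fun j => (j != a) && (j != b)) 7.

Lemma unmixed_heptagon O P : size O = 7 -> size P = 7 -> sources_bits 7 O P ->
  unmixed_bits 7 O P = sinks_bits 7 O P.
Proof.
move=> hO hP src; apply/idP/idP; last first.
  (* All minimal covers of C_7 have size 4. *)
  move=> sk; apply: (@unmixed_minimal _ _ _ 4) => //; by vm_compute.
move=> u; apply/allP => i hi; apply/implyP => Pi; apply/negPn/negP => nsk.
have hi7 : i < 7 by rewrite mem_iota in hi.
(* The search has weight <> 1 at [i] alone, so it runs over orientations and positions only. *)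
have : all (fun O => all (fun i =>
    (nth false O i == nth false O (cpred 7 i)) ==>
    let C := heptagon_cover O i in
    strong_bits 7 O (mkseq (fun j => j == i) 7) C && (count id C == 5)) (iota 0 7))
  (bits 7) by vm_compute.
move/allP/(_ O (etrans (mem_bits _ _) (introT eqP hO)))/allP/(_ i hi)/implyP.
(* As [i] is not a sink and, having weight <> 1, not a source, its two edges point the same way
   round the cycle. *)
move=> chk; have /chk/andP[str /eqP c5] : nth false O i == nth false O (cpred 7 i).
  move/allP/(_ i hi): src; rewrite Pi implybF; move: nsk.
  by case: nth; case: nth.
pose C4 := [:: false; true; false; true; false; true; true].
have min4 : minimal_bits 7 C4 by vm_compute.
have sub j : nth false (mkseq (fun j => j == i) 7) j -> nth false P j.
  have [hj|hj] := ltnP j 7; last by rewrite nth_default ?size_mkseq.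
  by rewrite nth_mkseq // => /eqP->.
have := unmixed_count u (size_mkseq _ _) (erefl : size C4 = 7)
          (strong_bits_mono sub str) (minimal_strong_bits _ _ min4).
by rewrite c5.
Qed.

(** * The types D_1 to D_4 read along an enumeration *)

Section FiveCyclePatterns.
Variables (V : finType) (D : wograph V).
Local Notation O y := (orientation D 5 y).
Local Notation P y := (nontrivial D 5 y).
Local Notation trivial v := (weight D v == 1).

Lemma dihedral5_five_cycle y a b c d f : enumerates_cycle D 5 y ->
  (a, b, c, d, f) \in dihedral5 -> five_cycle D (y a) (y b) (y c) (y d) (y f).
Proof.
move=> hy hs; pose l := [:: a; b; c; d; f].
have [ul ll al] : [/\ uniq l, forall i, i < 5 -> nth 0 l i < 5 &
    forall i j, i < 5 -> j < 5 ->
      (nth 0 l j == csucc 5 (nth 0 l i)) || (nth 0 l i == csucc 5 (nth 0 l j)) =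
      (j == i.+1 %% 5) || (i == j.+1 %% 5)].
  pose ok (s : index5) := let: (a, b, c, d, f) := s in let l := [:: a; b; c; d; f] in
    [&& uniq l, all (fun i => nth 0 l i < 5) (iota 0 5) &
      all (fun i => all (fun j =>
        ((nth 0 l j == csucc 5 (nth 0 l i)) || (nth 0 l i == csucc 5 (nth 0 l j))) ==
        ((j == i.+1 %% 5) || (i == j.+1 %% 5))) (iota 0 5)) (iota 0 5)].
  have /allP/(_ _ hs)/and3P[ul /allP ll /allP al] : all ok dihedral5 by vm_compute.
  have io k : k < 5 -> k \in iota 0 5 by rewrite mem_iota.
  split=> // [i /io/ll //|i j /io/al/allP al' /io/al'/eqP //].
have tE (i : 'I_5) : tnth [tuple y a; y b; y c; y d; y f] i = y (nth 0 l i).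
  by case: i => [[|[|[|[|[|]]]]]].
have [_ _ hinj hadj] := hy.
split; last by move=> i j; rewrite !tE hadj ?inE ?ll // al.
apply: inj_card_bij => [i j|].
  rewrite !tE => e; apply/val_inj/eqP; rewrite -(nth_uniq 0 _ _ ul) //=.
  by apply/eqP/(hinj _ _ _ _ e); rewrite inE ll.
by rewrite card_ord -cardsT (card_member_bits hy) (leq_trans (count_size _ _)) ?size_mkseq.
Qed.

Section Pattern.
Variables (Q : V -> V -> V -> V -> V -> bool) (F : seq bool -> seq bool -> index5 -> bool).
Hypothesis QF : forall y, enumerates_cycle D 5 y ->
  forall a b c d f, a < 5 -> b < 5 -> c < 5 -> d < 5 -> f < 5 ->
  Q (y a) (y b) (y c) (y d) (y f) = F (O y) (P y) (a, b, c, d, f).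

(** The labelling itself serves as the enumeration, so the pattern is found at the identity of
    [dihedral5]. *)
Lemma pattern_bits x1 x2 x3 x4 x5 :
  five_cycle D x1 x2 x3 x4 x5 -> Q x1 x2 x3 x4 x5 ->
  exists2 y, enumerates_cycle D 5 y & has (F (O y) (P y)) dihedral5.
Proof.
move=> /(cycle_labelling_enumerates (isT : 2 < 5)) [y hy yE] q; exists y => //.
apply/hasP; exists (0, 1, 2, 3, 4); first by rewrite inE eqxx.
have e (i : 'I_5) := yE i.
rewrite -(QF hy) // (e (Ordinal (isT : 0 < 5))) (e (Ordinal (isT : 1 < 5))).
by rewrite (e (Ordinal (isT : 2 < 5))) (e (Ordinal (isT : 3 < 5))) (e (Ordinal (isT : 4 < 5))).
Qed.

Lemma bits_pattern y :
  enumerates_cycle D 5 y -> has (F (O y) (P y)) dihedral5 ->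
  exists x1 x2 x3 x4 x5, five_cycle D x1 x2 x3 x4 x5 /\ Q x1 x2 x3 x4 x5.
Proof.
move=> hy /hasP[[[[[a b] c] d] f] hs Fs].
exists (y a), (y b), (y c), (y d), (y f); split; first exact: dihedral5_five_cycle.
have : all (fun s : index5 => let: (a, b, c, d, f) := s in
   [&& a < 5, b < 5, c < 5, d < 5 & f < 5]) dihedral5 by [].
by move=> /allP/(_ _ hs)/and5P[? ? ? ? ?]; rewrite (QF hy).
Qed.
End Pattern.

Definition D1_pattern x1 x2 x3 x4 x5 :=
  [&& edge D x2 x1, edge D x5 x1, edge D x4 x5, edge D x4 x3 & edge D x3 x2] &&
  [&& trivial x1, trivial x2, trivial x4, ~~ trivial x3 & ~~ trivial x5].

Definition D2_pattern x1 x2 x3 x4 x5 :=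
  [&& edge D x3 x2, edge D x2 x1 & edge D x1 x5] &&
  [&& ~~ trivial x1, ~~ trivial x2, trivial x3, trivial x4 & trivial x5].

Definition D3_pattern x1 x2 x3 x4 x5 :=
  [&& edge D x1 x5, edge D x5 x4 & edge D x4 x3] &&
  [&& trivial x1, trivial x2, ~~ trivial x3, ~~ trivial x4 & ~~ trivial x5].

Definition D4_pattern x1 x2 x3 x4 x5 :=
  [&& edge D x1 x2, edge D x2 x3, edge D x4 x3 & edge D x4 x5] &&
  [&& trivial x1, trivial x4, ~~ trivial x2, ~~ trivial x3 & ~~ trivial x5].

Section Bits.
Variables (y : nat -> V) (hy : enumerates_cycle D 5 y) (a b c d f : nat).
Hypotheses (ha : a < 5) (hb : b < 5) (hc : c < 5) (hd : d < 5) (hf : f < 5).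

Lemma D1_patternE : D1_pattern (y a) (y b) (y c) (y d) (y f) =
  D1_bits (O y) (P y) (a, b, c, d, f).
Proof.
by rewrite /D1_bits /D1_pattern -!(edge_bitsE hy) // !nontrivialE // !negbK.
Qed.

Lemma D2_patternE : D2_pattern (y a) (y b) (y c) (y d) (y f) =
  D2_bits (O y) (P y) (a, b, c, d, f).
Proof.
by rewrite /D2_bits /D2_pattern -!(edge_bitsE hy) // !nontrivialE // !negbK.
Qed.

Lemma D3_patternE : D3_pattern (y a) (y b) (y c) (y d) (y f) =
  D3_bits (O y) (P y) (a, b, c, d, f).
Proof.
by rewrite /D3_bits /D3_pattern -!(edge_bitsE hy) // !nontrivialE // !negbK.
Qed.

Lemma D4_patternE : D4_pattern (y a) (y b) (y c) (y d) (y f) =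
  D4_bits (O y) (P y) (a, b, c, d, f).
Proof.
by rewrite /D4_bits /D4_pattern -!(edge_bitsE hy) // !nontrivialE // !negbK.
Qed.
End Bits.

Lemma D1_patternP : is_D1 D <-> exists x1 x2 x3 x4 x5,
  five_cycle D x1 x2 x3 x4 x5 /\ D1_pattern x1 x2 x3 x4 x5.
Proof.
split=> -[x1 [x2 [x3 [x4 [x5 []]]]]] => [h [e1 e2 e3 e4 e5] [w1 w2 w4] [w3 w5]|h].
  exists x1, x2, x3, x4, x5; split=> //; rewrite /D1_pattern e1 e2 e3 e4 e5.
  by rewrite w1 w2 w4 /=; apply/andP; split; apply/eqP.
case/andP => /and5P[? ? ? ? ?] /and5P[/eqP ? /eqP ? /eqP ? /eqP ? /eqP ?].
by exists x1, x2, x3, x4, x5; split.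
Qed.

Lemma D2_patternP : is_D2 D <-> exists x1 x2 x3 x4 x5,
  five_cycle D x1 x2 x3 x4 x5 /\ D2_pattern x1 x2 x3 x4 x5.
Proof.
split=> -[x1 [x2 [x3 [x4 [x5 []]]]]] => [h [e1 e2 e3] [w1 w2] [w3 w4 w5]|h].
  exists x1, x2, x3, x4, x5; split=> //; rewrite /D2_pattern e1 e2 e3.
  by rewrite w3 w4 w5 !eqxx !andbT /=; apply/andP; split; apply/eqP.
case/andP => /and3P[? ? ?] /and5P[/eqP ? /eqP ? /eqP ? /eqP ? /eqP ?].
by exists x1, x2, x3, x4, x5; split.
Qed.

Lemma D3_patternP : is_D3 D <-> exists x1 x2 x3 x4 x5,
  five_cycle D x1 x2 x3 x4 x5 /\ D3_pattern x1 x2 x3 x4 x5.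
Proof.
split=> -[x1 [x2 [x3 [x4 [x5 []]]]]] => [h [e1 e2 e3] [w1 w2] [w3 w4 w5]|h].
  exists x1, x2, x3, x4, x5; split=> //; rewrite /D3_pattern e1 e2 e3.
  by rewrite w1 w2 /=; apply/and3P; split; apply/eqP.
case/andP => /and3P[? ? ?] /and5P[/eqP ? /eqP ? /eqP ? /eqP ? /eqP ?].
by exists x1, x2, x3, x4, x5; split.
Qed.

Lemma D4_patternP : is_D4 D <-> exists x1 x2 x3 x4 x5,
  five_cycle D x1 x2 x3 x4 x5 /\ D4_pattern x1 x2 x3 x4 x5.
Proof.
split=> -[x1 [x2 [x3 [x4 [x5 []]]]]] => [h [e1 e2 e3 e4] [w1 w4] [w2 w3 w5]|h].
  exists x1, x2, x3, x4, x5; split=> //; rewrite /D4_pattern e1 e2 e3 e4.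
  by rewrite w1 w4 /=; apply/and3P; split; apply/eqP.
case/andP => /and4P[? ? ? ?] /and5P[/eqP ? /eqP ? /eqP ? /eqP ? /eqP ?].
by exists x1, x2, x3, x4, x5; split.
Qed.

Lemma excluded5_bits : is_D1 D \/ is_D2 D \/ is_D3 D ->
  exists2 y, enumerates_cycle D 5 y & excluded5 (O y) (P y).
Proof.
case=> [/D1_patternP|[/D2_patternP|/D3_patternP]] [x1 [x2 [x3 [x4 [x5 [h]]]]]].
- case/(pattern_bits D1_patternE h) => y hy hD; exists y => //.
  by rewrite /excluded5 hD.
- case/(pattern_bits D2_patternE h) => y hy hD; exists y => //.
  by rewrite /excluded5 hD orbT.
- case/(pattern_bits D3_patternE h) => y hy hD; exists y => //.
  by rewrite /excluded5 hD !orbT.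
Qed.

Lemma bits_excluded5 y : enumerates_cycle D 5 y -> excluded5 (O y) (P y) ->
  is_D1 D \/ is_D2 D \/ is_D3 D.
Proof.
move=> hy /or3P[] h.
- by left; apply/D1_patternP/(bits_pattern D1_patternE hy h).
- by right; left; apply/D2_patternP/(bits_pattern D2_patternE hy h).
- by right; right; apply/D3_patternP/(bits_pattern D3_patternE hy h).
Qed.

Lemma trivial_edgeE y : enumerates_cycle D 5 y ->
  trivial_edge (P y) <->
  exists u v, [/\ edge D u v, weight D u = 1 & weight D v = 1].
Proof.
move=> hy; have [_ hs _ _] := hy; split=> [/hasP[i]|[u [v [uv wu wv]]]].
  rewrite mem_iota add0n /= => hi.
  rewrite !nontrivialE ?(csucc_lt hy) // !negbK => /andP[/eqP wi /eqP wn].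
  by case/orP: (adj_csucc hy hi) => e; [exists (y i), (y (csucc 5 i))|exists (y (csucc 5 i)), (y i)].
have [i hi iu] := hs u; have [j hj jv] := hs v; subst u v.
move: uv; rewrite (edge_bitsE hy) // => /orP[]/andP[/eqP e _];
  apply/hasP; [exists i|exists j]; rewrite ?mem_iota //; rewrite -e !nontrivialE //;
  by rewrite wu wv.
Qed.

End FiveCyclePatterns.

(** * Classification of the unmixed oriented cycles *)

Theorem theorem4p20 (K : fieldType) (n : nat) (V : finType) (D : wograph V)
  (hn : (3 <= n)%N)
  (hsource : forall x : V, source D x -> weight D x = 1%N)
  (hcycle : underlying_cycle n D) :
  unmixed (@edge_ideal K V D) <->
  [\/ n = 3%N /\ (exists x : V, weight D x = 1%N),
      (n = 4%N \/ n = 5%N \/ n = 7%N) /\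
        (forall x : V, x \in Vplus D -> sink D x),
      [/\ n = 5%N,
          (exists x y : V,
             [/\ edge D x y, weight D x = 1%N & weight D y = 1%N]),
          ~ is_D1 D, ~ is_D2 D & ~ is_D3 D]
    | is_D4 D].
Proof.
have [x hx] := hcycle; have [y hy _] := cycle_labelling_enumerates hn hx.
have sizeO m z : size (orientation D m z) = m by apply: size_mkseq.
have sizeP m z : size (nontrivial D m z) = m by apply: size_mkseq.
have src m z (hz : enumerates_cycle D m z) := sourcesE hz hsource.
have check5 z (hz : enumerates_cycle D 5 z) :=
  five_checkP (sizeO 5 z) (sizeP 5 z) (src 5 z hz).
have not_excluded z (hz : enumerates_cycle D 5 z) :
    unmixed_bits 5 (orientation D 5 z) (nontrivial D 5 z) ->
    ~ (is_D1 D \/ is_D2 D \/ is_D3 D).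
  (* An excluded labelling comes with its own enumeration [t]; unmixedness of the ideal carries the
     bit test from [z] to [t]. *)
  move=> uz /excluded5_bits[t ht et].
  have /and5P[_ /implyP/(_ et)/negP nu _ _ _] := check5 t ht.
  by apply: nu; apply/(unmixed_bitsP ht K)/(unmixed_bitsP hz K).
split=> [/(unmixed_bitsP hy) u|].
  have [n3|n3] := eqVneq n 3.
    subst n; apply: Or41; split=> //; move: u.
    rewrite unmixed_triangle ?src // => /hasP[p /mapP[i _ ->]].
    by rewrite negbK => /eqP; exists (y i).
  have [n4|n4] := eqVneq n 4.
    subst n; apply: Or42; split; first by left.
    by apply/(sinksE hy); rewrite -unmixed_square ?src.
  have [n7|n7] := eqVneq n 7.
    subst n; apply: Or42; split; first by right; right.
    by apply/(sinksE hy); rewrite -unmixed_heptagon ?src.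
  have [n5|n5] := eqVneq n 5; last first.
    have n6 : 6 <= n by lia.
    by move: u; rewrite (negPf (cycle_not_well_covered _ _ n6 n7)).
  subst n; have nD := not_excluded y hy u.
  have /and5P[/implyP/(_ u) c _ _ _ _] := check5 y hy.
  case/or3P: c => h.
  - by apply: Or42; split; [right; left | apply/(sinksE hy)].
  - apply: Or43; split=> //; first exact/(trivial_edgeE hy).
    + by move=> h1; apply: nD; left.
    + by move=> h2; apply: nD; right; left.
    + by move=> h3; apply: nD; right; right.
  - by apply: Or44; apply/D4_patternP/(bits_pattern (@D4_patternE V D) hy h).
case=> [[n3 [v wv]]|[n457 /(sinksE hy) sk]|[n5 te n1 n2 n3]|/D4_patternP].
- subst n; apply/(unmixed_bitsP hy); rewrite unmixed_triangle ?src //.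
  have [_ hs _ _] := hy; have [i hi iv] := hs v.
  apply/(has_nthP false); exists i; rewrite ?sizeP // nontrivialE // iv wv.
  by [].
- apply/(unmixed_bitsP hy); case: n457 => [n4|[n5|n7]]; subst n.
  + by rewrite unmixed_square ?src.
  + by have /and5P[_ _ _ /implyP + _] := check5 y hy; apply.
  + by rewrite unmixed_heptagon ?src.
- subst n; apply/(unmixed_bitsP hy).
  have /and5P[_ _ _ _ /implyP] := check5 y hy; apply; apply/andP; split.
    exact/(trivial_edgeE hy).
  by apply/negP => /(bits_excluded5 hy) [|[]].
case=> x1 [x2 [x3 [x4 [x5 [h]]]]].
(* The D_4 labelling brings an enumeration [z] of length 5, along which unmixedness is read instead
   of along [y]. *)
case/(pattern_bits (@D4_patternE V D) h) => z hz hD.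
apply/(unmixed_bitsP hz).
by have /and5P[_ _ /implyP/(_ hD)] := check5 z hz.
Qed.
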